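(* Let $\mathcal{G}$ be a simple graph with $n$ vertices, and let $X$ be the algebraic toric set associated to $\mathcal{G}$ over $K=\mathbb{F}_q$. Suppose $\mathcal{G}$ has $m$ connected components, of which $\gamma$ are non-bipartite. Then $$|X|=\begin{cases}\left(\tfrac12\right)^{\gamma-1}(q-1)^{n-m+\gamma-1}, & \text{if } \gamma\geq 1 \text{ and } q \text{ is odd},\\ (q-1)^{n-m+\gamma-1}, & \text{if } \gamma\geq 1 \text{ and } q\text{ is even},\\ (q-1)^{n-m-1}, & \text{if } \gamma=0.\end{cases}$$
   Context: $K=\mathbb{F}_q$ is a finite field with $q>2$ elements and $K^*=K\setminus\{0\}$. $\mathbb{P}^{s-1}$ is the projective space of dimension $s-1$ over $K$, i.e. the set of classes $[\mathbf{x}]$ of nonzero vectors of $K^s$ modulo multiplication by scalars in $K^*$. Graphs are simple, without isolated vertices and with at least two edges. For a graph $\mathcal{G}$ with vertices $v_1,\dots,v_n$ and edges $e_1,\dots,e_s$, for $\mathbf{x}=(x_1,\dots,x_n)\in(K^* )^n$ and an edge $e_i=\{v_j,v_k\}$ put $\mathbf{x}^{e_i}=x_jx_k$. The algebraic toric set associated to $\mathcal{G}$ is $X=\{[(\mathbf{x}^{e_1},\dots,\mathbf{x}^{e_s})] : \mathbf{x}\in(K^* )^n\}\subset\mathbb{P}^{s-1}$. ($|X|$ is the length of the parameterized linear codes associated to $\mathcal{G}$.) *)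

(* Defs.v *)
From HB Require Import structures.
From mathcomp Require Import all_boot all_order all_algebra.

Set Implicit Arguments.
Unset Strict Implicit.
Unset Printing Implicit Defensive.

Import GRing.Theory.
Local Open Scope ring_scope.

(* A simple graph is a symmetric irreflexive relation e on a vertex type V. *)
Definition edges (V : finType) (e : rel V) : {set {set V}} :=
  [set [set p.1; p.2] | p : V * V & e p.1 p.2].

Definition components (V : finType) (e : rel V) : {set {set V}} :=
  equivalence_partition (connect e) [set: V].

Definition bipartite (V : finType) (e : rel V) (C : {set V}) : bool :=
  [exists A : {set V}, exists B : {set V},
    [&& A :|: B == C, [disjoint A & B] &
        [forall u in C, forall v in C,
           e u v ==> (u \in A) && (v \in B) || (u \in B) && (v \in A)]]].

(* A projective point [v] is represented by its class, the set of all nonzero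
   multiples of v; two vectors have the same class iff they are proportional
   by a nonzero scalar. *)
Definition proj_class (K : finFieldType) (s : nat) (v : 'rV[K]_s)
    : {set 'rV[K]_s} :=
  [set c *: v | c : K & c != 0].

Definition proj_space (K : finFieldType) (s : nat) : {set {set 'rV[K]_s}} :=
  [set proj_class v | v : 'rV[K]_s & v != 0].

(* As A runs over two-element sets {v_j, v_k}, this is x_j * x_k. *)
Definition edge_monomial (K : finFieldType) (V : finType) (x : {ffun V -> K})
    (A : {set V}) : K :=
  \prod_(v in A) x v.

(* The edges are listed as e_i = enum_val i, i < s. *)
Definition monomial_vector (K : finFieldType) (V : finType) (e : rel V)
    (x : {ffun V -> K}) : 'rV[K]_#|edges e| :=
  \row_i edge_monomial x (enum_val i).

Definition toric_set (K : finFieldType) (V : finType) (e : rel V)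
    : {set {set 'rV[K]_#|edges e|}} :=
  [set proj_class (monomial_vector e x) |
    x : {ffun V -> K} & [forall v, x v != 0]].

Lemma proj_class_eq (K : finFieldType) (s : nat) (v w : 'rV[K]_s) :
  proj_class v = proj_class w <-> exists2 c : K, c != 0 & w = c *: v.
Proof.
split=> [vw | [c c0 ->]].
  have: w \in proj_class w.
    by apply/imsetP; exists 1; rewrite ?inE ?oner_eq0 // scale1r.
  by rewrite -vw => /imsetP[c]; rewrite inE => c0 ->; exists c.
apply/setP=> u; apply/imsetP/imsetP => -[d]; rewrite inE => d0 ->.
  exists (d / c); first by rewrite inE mulf_neq0 ?invr_eq0.
  by rewrite scalerA divfK.
by exists (d * c); rewrite ?inE ?mulf_neq0 ?scalerA.
Qed.

Lemma edge_monomial_pair (K : finFieldType) (V : finType) (x : {ffun V -> K})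
    (u v : V) :
  u != v -> edge_monomial x [set u; v] = x u * x v.
Proof. by move=> uv; rewrite /edge_monomial big_setU1 ?inE //= big_set1. Qed.

Lemma toric_set_sub (K : finFieldType) (V : finType) (e : rel V) :
  (0 < #|edges e|)%N -> toric_set K e \subset proj_space K #|edges e|.
Proof.
move=> s0; apply/subsetP=> _ /imsetP[x + ->]; rewrite inE => /forallP x0.
apply/imsetP; exists (monomial_vector e x) => //; rewrite inE.
apply/negP=> /eqP/rowP/(_ (Ordinal s0))/eqP; rewrite !mxE.
by apply/negP/prodf_neq0.
Qed.

(* Main.v *)
(* The monomial map sends the torus (K^* )^n onto X, and y and x have the same
   image iff z = y / x satisfies z_u z_v = c on every edge uv, for one scalar
   c <> 0; so |X| is (q - 1)^n divided by the number of such z, summed over c.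
   Along an edge z alternates between t and c / t. Hence a bipartite component
   contributes q - 1 solutions (t is free), while on a non-bipartite component
   t = c / t, so z is constant there, equal to a square root of c. With r(c)
   square roots of c, the number of z is the sum over c <> 0 of
   (q - 1)^(m - gamma) r(c)^gamma. For q even r(c) = 1; for q odd r(c) is 0 or 2
   and the r(c) add up to q - 1. *)

Require Import Defs.
From HB Require Import structures.
From mathcomp Require Import all_boot all_order all_algebra.
From mathcomp Require Import fingroup cyclic finfield zify.

Set Implicit Arguments.
Unset Strict Implicit.
Unset Printing Implicit Defensive.

Import Order.TTheory GRing.Theory Num.Theory.
Local Open Scope ring_scope.

(** * Square roots in a finite field *)

Section FiniteFieldSquares.

Variable K : finFieldType.

Lemma card_neq0 : #|[set c : K | c != 0]| = #|K|.-1.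
Proof. by rewrite -(cardsC1 (0 : K)); apply: eq_card => c; rewrite !inE. Qed.

(** If 2 = 0, then 1 has additive order 2, which divides the order of the additive group of [K]. *)
Lemma finField_odd_two_neq0 : odd #|K| -> 2%:R != 0 :> K.
Proof.
apply: contraTneq => two0.
have one_order : #[(1%R : K)]%g = 2%N.
  by apply: nt_prime_order => //; rewrite ?FinRing.zmodXgE ?oner_eq0.
by have := order_dvdG (in_setT (1%R : K)); rewrite one_order cardsT dvdn2.
Qed.

(** Every element is its own power of exponent [#|K|], and an even power of -1 is 1. *)
Lemma finField_even_oppr1 : ~~ odd #|K| -> -1 = 1 :> K.
Proof.
by move=> evenK; rewrite -{1}[-1 : K]expf_card -signr_odd (negbTE evenK). Qed.

Definition sqroots (c : K) : {set K} := [set t | (t != 0) && (t ^+ 2 == c)].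

(** Each nonzero [t] is a square root of exactly one [c], namely [t ^+ 2]. *)
Lemma sum_card_sqroots : (\sum_(c : K | c != 0%R) #|sqroots c| = #|K|.-1)%N.
Proof.
rewrite -card_neq0 -sum1_card.
rewrite [RHS](partition_big (fun t => t ^+ 2) (fun c => c != 0)) => [|t]; last first.
  by rewrite inE => t0; rewrite expf_neq0.
apply: eq_bigr => c _; rewrite -sum1_card.
by apply: eq_bigl => t; rewrite !inE.
Qed.

(** A root [t] comes with [- t], and the two differ because 2t is nonzero. *)
Lemma card_sqroots_odd (c : K) :
  odd #|K| -> (#|sqroots c| == 0%N) || (#|sqroots c| == 2%N).
Proof.
move=> /finField_odd_two_neq0 two0; rewrite cards_eq0.
have [-> | [t]] := set_0Vmem (sqroots c); first by rewrite eqxx.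
rewrite inE => /andP[t0 /eqP tc].
suff -> : sqroots c = [set t; - t].
  rewrite cards2 -addr_eq0 -mulr2n -mulr_natl mulf_neq0 // ?orbT //.
apply/setP=> u; rewrite !inE -tc eqf_sqr andb_idl //.
by case/orP=> /eqP->; rewrite ?oppr_eq0.
Qed.

(** Since -1 = 1, squaring is injective, hence bijective on the finite set [K]. *)
Lemma card_sqroots_even (c : K) : ~~ odd #|K| -> c != 0 -> #|sqroots c| = 1%N.
Proof.
move=> /finField_even_oppr1 N1 c0.
have sqI : injective (fun t : K => t ^+ 2).
  move=> t u /eqP; rewrite eqf_sqr -(mulN1r u) N1 mul1r orbb.
  by move/eqP.
pose t := invF sqI c; have tc : t ^+ 2 = c by rewrite (f_invF sqI).
apply/eqP/cards1P; exists t; apply/setP=> u; rewrite !inE -tc (inj_eq sqI).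
by apply: andb_idl => /eqP->; apply: contraNneq c0 => t0; rewrite -tc t0 expr0n.
Qed.

(** For r equal to 0 or 2, r^(g+1) = 2^g r; the positive exponent is what makes this hold at r =
    0. *)
Lemma sum_card_sqroots_exp_odd g : odd #|K| ->
  (\sum_(c : K | c != 0%R) #|sqroots c| ^ g.+1 = 2 ^ g * #|K|.-1)%N.
Proof.
move=> oddK; rewrite -sum_card_sqroots big_distrr; apply: eq_bigr => c _.
by case/orP: (card_sqroots_odd c oddK) => /eqP->; rewrite /= ?exp0n ?muln0 ?expnSr.
Qed.

Lemma sum_card_sqroots_exp_even g : ~~ odd #|K| ->
  (\sum_(c : K | c != 0%R) #|sqroots c| ^ g = #|K|.-1)%N.
Proof.
move=> evenK; rewrite -sum_card_sqroots; apply: eq_bigr => c c0.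
by rewrite card_sqroots_even ?exp1n.
Qed.

End FiniteFieldSquares.

(** * The equations z_u z_v = c on the edges *)

Section EdgeEquations.

Variables (K : finFieldType) (V : finType) (e : rel V).
Hypothesis e_sym : symmetric e.

Definition torus : {set {ffun V -> K}} :=
  [set x : {ffun V -> K} | [forall v, x v != 0]].

Lemma torusP (x : {ffun V -> K}) : reflect (forall v, x v != 0) (x \in torus).
Proof. by rewrite inE; apply: forallP. Qed.

Lemma card_torus : #|torus| = (#|K|.-1 ^ #|V|)%N.
Proof.
rewrite -card_neq0 -card_ffun_on; apply: eq_card => x; rewrite inE.
by apply: eq_forallb => v; rewrite !inE.
Qed.

Definition edge_solutions (c : K) : {set {ffun V -> K}} :=
  [set z : {ffun V -> K} in torus |
    [forall u, forall v, e u v ==> (z u * z v == c)]].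

Lemma edge_solutionsP (c : K) (z : {ffun V -> K}) :
  reflect ((forall v, z v != 0) /\ (forall u v, e u v -> z u * z v = c))
          (z \in edge_solutions c).
Proof.
rewrite inE; apply: (iffP andP) => -[/torusP z0 zc]; split=> //.
  by move=> u v uv; have /forallP/(_ u)/forallP/(_ v)/implyP/(_ uv)/eqP := zc.
by apply/forallP=> u; apply/forallP=> v; apply/implyP=> /zc ->.
Qed.

(** * Connected components and two-colourings *)

Definition component (v : V) : {set V} := [set w in [set: V] | connect e v w].

Lemma mem_component v w : (w \in component v) = connect e v w.
Proof. by rewrite !inE. Qed.

Lemma component_in v : component v \in components e.
Proof. exact: imset_f. Qed.

Lemma component_eq u v : connect e u v -> component u = component v.
Proof.
move=> uv; apply/setP=> w; rewrite !mem_component.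
exact: same_connect (sym_connect_sym e_sym) _ _ uv _.
Qed.

(** By symmetry of [e], a predicate that passes along every edge one way also passes back, so it is
    constant on components. *)
Lemma connect_invariant (P : pred V) v w :
  (forall a b, e a b -> P a -> P b) -> connect e v w -> P v -> P w.
Proof.
move=> stepP vw Pv; suff clP : closed e P.
  by rewrite -[P w]/(w \in P) -(closed_connect clP vw).
by apply: (intro_closed (sym_connect_sym e_sym)) => a b; apply: stepP.
Qed.

(** One global colouring serves all bipartite components; its values elsewhere are arbitrary, and
    [flips] ignores them. *)
Definition proper_on_bipartite (col : pred V) : Prop :=
  forall u v, e u v -> bipartite e (component u) -> col u != col v.

(** The side is chosen as a function of the component, so both ends of an edge consult the same set,
    and exactly one end lies in it. *)
Lemma proper_on_bipartite_exists : exists col : pred V, proper_on_bipartite col.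
Proof.
pose sideof C : {set V} := odflt set0 [pick A : {set V} |
  [exists B : {set V}, [&& A :|: B == C, [disjoint A & B] &
     [forall u in C, forall v in C,
        e u v ==> (u \in A) && (v \in B) || (u \in B) && (v \in A)]]]].
exists (fun v => v \in sideof (component v)) => u v uv /existsP bip.
rewrite -(component_eq (connect1 uv)) /sideof.
case: pickP => [A /existsP[B /and3P[_ AB edgeAB]] | noA]; last first.
  by case: bip => A; rewrite noA.
have uC : u \in component u by rewrite mem_component.
have vC : v \in component u by rewrite mem_component connect1.
move/forall_inP/(_ u uC)/forall_inP/(_ v vC)/implyP/(_ uv): edgeAB => /=.
case/orP=> /andP[ua vb].
  by rewrite ua (disjointFl AB vb).
by rewrite vb (disjointFl AB ua).
Qed.

(** [P] and its complement cut the component into the two sides. *)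
Lemma coloring_bipartite v (P : pred V) :
  (forall a b, a \in component v -> e a b -> P a != P b) ->
  bipartite e (component v).
Proof.
move=> alt; set C := component v.
apply/existsP; exists [set w in C | P w].
apply/existsP; exists [set w in C | ~~ P w]; apply/and3P; split.
- by apply/eqP/setP=> w; rewrite !inE -andb_orr orbN andbT.
- by apply/pred0P=> w /=; rewrite !inE; case: (P w); rewrite ?andbF.
apply/forall_inP=> a aC; apply/forall_inP=> b bC; apply/implyP=> ab.
rewrite !(inE, in_set) -!mem_component -/C aC bC /=.
by move: (alt a b aC ab); case: (P a); case: (P b).
Qed.

(** * Solutions described by one value per component *)

Section Parameterization.

Variables (c : K) (col : pred V).
Hypotheses (c_neq0 : c != 0) (col_proper : proper_on_bipartite col).

(* On a bipartite component a solution takes the value t on one side and c / t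
   on the other; on a non-bipartite one these two values coincide. *)
Definition component_values (C : {set V}) : pred K :=
  if bipartite e C then mem [set t : K | t != 0] else mem (sqroots c).

Definition flips (v : V) : bool := bipartite e (component v) && col v.

Definition spread (f : {ffun {set V} -> K}) : {ffun V -> K} :=
  [ffun v => if flips v then c / f (component v) else f (component v)].

(** The value 0 is imposed off the components, so that each choice of parameters is a single
    function. *)
Let params := pfamily 0 (mem (components e)) component_values.

Lemma params_neq0 f v : f \in params -> f (component v) != 0.
Proof.
case/pfamilyP=> _ /(_ _ (component_in v)); rewrite /component_values.
by case: ifP => _; rewrite !inE // => /andP[].
Qed.

(** On a bipartite component exactly one end of an edge is flipped, giving t (c / t) = c; elsewhere
    t^2 = c. *)
Lemma spread_solution f : f \in params -> spread f \in edge_solutions c.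
Proof.
move=> fP; apply/edge_solutionsP; split=> [v | u v uv]; rewrite !ffunE.
  by case: ifP => _; rewrite ?mulf_neq0 ?invr_eq0 ?params_neq0.
have f0 := params_neq0 u fP; rewrite /flips -(component_eq (connect1 uv)).
have [bip | nbip] /= := boolP (bipartite e (component u)).
  have := col_proper uv bip.
  by case: (col u); case: (col v); rewrite // ?divfK // mulrC divfK.
case/pfamilyP: fP => _ /(_ _ (component_in u)).
by rewrite /component_values (negbTE nbip) !inE => /andP[_ /eqP].
Qed.

Lemma spread_inj : {in params &, injective spread}.
Proof.
move=> f g fP gP fg; apply/ffunP=> C.
have [/imsetP[v _ ->] | nC] := boolP (C \in components e); last first.
  have supp0 h : h \in params -> h C = 0.
    by case/pfamilyP=> /supportP/(_ C nC).
  by rewrite !supp0.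
move/ffunP/(_ v): fg; rewrite !ffunE -/(component v).
case: ifP => // _ /(mulfI c_neq0); exact: invr_inj.
Qed.

(** An edge forces [z b = c / z a], so the value at [v] propagates through its component. *)
Lemma solution_component z v : z \in edge_solutions c ->
  exists2 t : K, t \in component_values (component v) &
    forall w, w \in component v -> z w = if flips w then c / t else t.
Proof.
case/edge_solutionsP=> z0 zc.
have step a b : e a b -> z b = c / z a.
  by move=> /zc <-; rewrite mulrC mulKf.
have cdivK t : t != 0 -> c / (c / t) = t.
  by move=> t0; rewrite invf_div mulrC divfK.
have [bip | nbip] := boolP (bipartite e (component v)).
  (* The parameter is the value on the unflipped side, which is [c / z v] when [v] itself is
     flipped. *)
  have t0 : (if col v then c / z v else z v) != 0.
    by case: ifP; rewrite ?mulf_neq0 ?invr_eq0.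
  set t := (if _ then _ else _) in t0.
  exists t => [|w]; first by rewrite /component_values bip !inE.
  rewrite mem_component => vw; apply/eqP; rewrite /flips -(component_eq vw) bip.
  (* Bipartiteness is carried in the invariant because [col_proper] asks for it at each edge. *)
  pose P w := (bipartite e (component w)) &&
              (z w == if col w then c / t else t).
  suff: P w by case/andP.
  apply: connect_invariant vw _ => [a b ab /andP[bipa /eqP za] |].
    rewrite /P -(component_eq (connect1 ab)) bipa (step _ _ ab) za /=.
    have := col_proper ab bipa.
    by case: (col a); case: (col b); rewrite // cdivK.
  by rewrite /P bip /t; case: (col v); rewrite ?cdivK /=.
have flipF w : w \in component v -> flips w = false.
  by rewrite mem_component /flips => /component_eq <-; rewrite (negbTE nbip).
have cz : c / z v = z v.
  (* Otherwise [z] alternates between the two distinct values [z v] and [c / z v], which two-colours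
     the component. *)
  apply: contraNeq nbip => cz.
  apply: (@coloring_bipartite _ (fun w => z w == z v)) => a b.
  rewrite mem_component => va ab; rewrite (step _ _ ab).
  have : (z a == z v) || (z a == c / z v).
    apply: (@connect_invariant
      (fun a => (z a == z v) || (z a == c / z v)) v) => //.
      move=> u w uw /orP[] /eqP zu; rewrite (step _ _ uw) zu ?cdivK // eqxx //.
      by rewrite orbT.
    by rewrite eqxx.
  case/orP=> /eqP->; rewrite ?cdivK // eqxx ?(negbTE cz) //.
exists (z v) => [|w vw].
  rewrite /component_values (negbTE nbip) !inE z0 /= expr2.
  by rewrite -{2}cz mulrC divfK.
rewrite flipF //; apply/eqP; move: vw; rewrite mem_component => vw.
apply: (@connect_invariant (fun w => z w == z v) v) => // a b ab /eqP za.
by rewrite (step _ _ ab) za cz.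
Qed.

Lemma spread_onto z : z \in edge_solutions c -> z \in spread @: params.
Proof.
move=> zP.
have val_ex C : C \in components e ->
    exists t : K, (t \in component_values C) &&
      [forall w in C, z w == if flips w then c / t else t].
  case/imsetP=> v _ ->; have [t tC zt] := solution_component v zP.
  by exists t; rewrite tC; apply/forall_inP=> w wC; rewrite zt.
(* The default 0 off the components matches the one imposed by [params]. *)
pose f : {ffun {set V} -> K} := [ffun C => odflt 0 [pick t |
   [&& C \in components e, t \in component_values C &
       [forall w in C, z w == if flips w then c / t else t]]]].
have fC C : C \in components e -> (f C \in component_values C) &&
    [forall w in C, z w == if flips w then c / f C else f C].
  move=> CP; rewrite ffunE; case: pickP => [t /andP[] // | none].
  by have [t tP] := val_ex C CP; have := none t; rewrite CP tP.
apply/imsetP; exists f.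
  apply/pfamilyP; split=> [|C /fC/andP[] //].
  apply/supportP=> C nC; rewrite ffunE.
  by case: pickP => // t /andP[CP]; rewrite CP in nC.
apply/ffunP=> v; rewrite ffunE; apply/eqP.
have /andP[_ /forall_inP] := fC _ (component_in v).
by apply; rewrite mem_component.
Qed.

Lemma card_edge_solutions_spread : #|edge_solutions c| = #|params|.
Proof.
rewrite -(card_in_imset spread_inj); apply: eq_card => z.
apply/idP/idP => [/spread_onto // | /imsetP[f fP ->]].
exact: spread_solution.
Qed.

End Parameterization.

(** The choices on distinct components are independent, so their numbers multiply. *)
Lemma card_edge_solutions (c : K) (m gamma : nat) : c != 0 ->
  #|components e| = m ->
  #|[set C in components e | ~~ bipartite e C]| = gamma ->
  #|edge_solutions c| = (#|K|.-1 ^ (m - gamma) * #|sqroots c| ^ gamma)%N.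
Proof.
move=> c0 cm cg; have [col colP] := proper_on_bipartite_exists.
rewrite (card_edge_solutions_spread c0 colP) card_pfamily foldrE big_map.
rewrite big_enum /= (bigID (bipartite e)) /=; congr (_ * _)%N.
  rewrite (eq_bigr (fun=> #|K|.-1)) => [|C /andP[_ bip]]; last first.
    by rewrite -card_neq0; apply: eq_card => t; rewrite /component_values bip.
  rewrite prod_nat_const; congr (_ ^ _)%N.
  rewrite -cm -cg -(cardsID [set C | bipartite e C] (components e)).
  rewrite -[X in (_ + X - _)%N](eq_card
    (A := [set C in components e | ~~ bipartite e C])).
    by rewrite addnK; apply: eq_card => C; rewrite !inE.
  by move=> C; rewrite !inE andbC.
rewrite (eq_bigr (fun=> #|sqroots c|)) => [|C /andP[_ nbip]]; last first.
  by apply: eq_card => t; rewrite /component_values (negbTE nbip).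
rewrite prod_nat_const -cg; congr (_ ^ _)%N.
by apply: eq_card => C; rewrite !inE.
Qed.

(** * Fibres of the monomial map *)

Hypothesis e_irr : irreflexive e.

Lemma edge_neq u v : e u v -> u != v.
Proof. by apply: contraTneq => ->; rewrite e_irr. Qed.

Lemma proj_class_monomialP (x y : {ffun V -> K}) :
  reflect (exists2 c : K, c != 0 &
             forall u v, e u v -> y u * y v = c * (x u * x v))
    (proj_class (monomial_vector e x) == proj_class (monomial_vector e y)).
Proof.
apply: (iffP eqP) => [/proj_class_eq[c c0 yx] | [c c0 yx]].
  exists c => // u v uv.
  have uvE : [set u; v] \in edges e.
    by apply/imsetP; exists (u, v); rewrite ?inE.
  move/rowP/(_ (enum_rank_in uvE [set u; v])): yx.
  by rewrite !mxE enum_rankK_in // !edge_monomial_pair ?edge_neq.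
apply/proj_class_eq; exists c => //; apply/rowP=> i; rewrite !mxE.
have /imsetP[[u v]] := enum_valP i; rewrite inE /= => uv ->.
by rewrite !edge_monomial_pair ?edge_neq // yx.
Qed.

(** Any single edge determines the scalar. *)
Lemma edge_solutions_scalar_uniq c d z : (0 < #|edges e|)%N ->
  z \in edge_solutions c -> z \in edge_solutions d -> c = d.
Proof.
case/card_gt0P=> A /imsetP[[u v]]; rewrite inE /= => uv _.
by case/edge_solutionsP=> _ /(_ _ _ uv) <- /edge_solutionsP[_ /(_ _ _ uv)].
Qed.

(** The torus splits into fibres over the points of X, and all fibres have the same size. *)
Lemma card_toric_set_edge_solutions : (0 < #|edges e|)%N ->
  (#|toric_set K e| * \sum_(c : K | c != 0%R) #|edge_solutions c|
     = #|K|.-1 ^ #|V|)%N.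
Proof.
move=> s0; rewrite -card_torus -[#|torus|]sum1_card.
rewrite (partition_big_imset (fun x => proj_class (monomial_vector e x))) /=.
rewrite -sum_nat_const; apply: eq_bigr => _ /imsetP[x xT ->].
have x0 : forall v, x v != 0 by apply/torusP.
pose sols := [set z | [exists c : K, (c != 0) && (z \in edge_solutions c)]].
have -> : (\sum_(c : K | c != 0%R) #|edge_solutions c| = #|sols|)%N.
  have -> : sols = \bigcup_(c : K | c != 0%R) edge_solutions c.
    apply/setP=> z; rewrite inE.
    apply/existsP/bigcupP => [[c /andP[]]|[c]]; first by exists c.
    by exists c; apply/andP.
  (* [g] recovers the scalar of a solution, so the sets [edge_solutions c] are disjoint and their
     sizes add up. *)
  pose g z : K := odflt 0 [pick c | z \in edge_solutions c].
  have gE c z : z \in edge_solutions c -> g z = c.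
    move=> zc; rewrite /g; case: pickP => [d zd | /(_ c)]; last by rewrite zc.
    exact: edge_solutions_scalar_uniq zd zc.
  rewrite -[RHS]sum1_card (partition_big g (fun c => c != 0)) => [|z]; last first.
    by case/bigcupP=> c c0 /gE ->.
  apply: eq_bigr => c c0; rewrite -sum1_card; apply: eq_bigl => z.
  apply/idP/andP => [zc | [/bigcupP[d _ zd] /eqP <-]]; last by rewrite (gE d).
  by rewrite (gE c) //; split=> //; apply/bigcupP; exists c.
(* Multiplication by [x] maps [sols] bijectively onto the fibre through [x]. *)
pose scale (z : {ffun V -> K}) : {ffun V -> K} := [ffun v => x v * z v].
have scale_inj : injective scale.
  move=> z w /ffunP zw; apply/ffunP=> v.
  by have := zw v; rewrite !ffunE => /(mulfI (x0 v)).
rewrite sum1_card -(card_imset sols scale_inj); apply: eq_card => y.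
rewrite [RHS]inE; apply/imsetP/andP => [[z zP ->] | [yT]].
  move: zP; rewrite inE => /existsP[c /andP[c0 /edge_solutionsP[z0 zc]]].
  split; first by apply/torusP=> v; rewrite ffunE mulf_neq0.
  rewrite eq_sym; apply/proj_class_monomialP; exists c => // u v uv.
  by rewrite !ffunE mulrACA zc // mulrC.
rewrite eq_sym => /proj_class_monomialP[c c0 yx].
exists [ffun v => y v / x v]; last first.
  by apply/ffunP=> v; rewrite !ffunE mulrC divfK.
rewrite inE; apply/existsP; exists c; rewrite c0.
apply/edge_solutionsP; split=> [v | u v uv]; rewrite !ffunE.
  by rewrite mulf_neq0 ?invr_eq0 //; apply/torusP: v.
by rewrite mulrACA -invfM yx // mulfK ?mulf_neq0.
Qed.

Lemma card_components_le : (#|components e| <= #|V|)%N.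
Proof. by rewrite -cardsT; apply: leq_imset_card. Qed.

End EdgeEquations.

(** * Solving the counting identity for |X|, case by case *)

Theorem theorem3p2 (K : finFieldType) (V : finType) (e : rel V)
    (q n m gamma : nat)
    (e_sym : symmetric e) (e_irr : irreflexive e)
    (e_noiso : forall v : V, exists w : V, e v w)
    (e_two : (2 <= #|edges e|)%N)
    (Kq : #|K| = q) (q_gt2 : (2 < q)%N)
    (Vn : #|V| = n)
    (comp_m : #|components e| = m)
    (comp_gamma : #|[set C in components e | ~~ bipartite e C]| = gamma) :
  [/\ (1 <= gamma)%N -> odd q ->
        #|toric_set K e|%:R
          = (1 / 2) ^+ (gamma - 1) * (q%:R - 1) ^+ (n - m + gamma - 1) :> rat,
      (1 <= gamma)%N -> ~~ odd q ->
        #|toric_set K e|%:R = (q%:R - 1) ^+ (n - m + gamma - 1) :> rat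
    & gamma = 0%N ->
        #|toric_set K e|%:R = (q%:R - 1) ^+ (n - m - 1) :> rat].
Proof.
have m_le_n : (m <= n)%N by rewrite -comp_m -Vn card_components_le.
have g_le_m : (gamma <= m)%N.
  by rewrite -comp_m -comp_gamma; apply/subset_leq_card/subsetP=> C; case/setIdP.
have q1_gt1 : (1 < q.-1)%N by case: q q_gt2 {Kq} => [|[]].
have q1E : q%:R - 1 = q.-1%:R :> rat by rewrite -subn1 natrB // ltnW // ltnW.
have := card_toric_set_edge_solutions K e_irr (ltnW e_two).
rewrite (eq_bigr _ (fun c c0 => card_edge_solutions e_sym c0 comp_m comp_gamma)).
rewrite -big_distrr /= Kq Vn => card_eq; rewrite q1E; split.
- case: gamma comp_gamma g_le_m card_eq => // g _ g_le_m + _ oddq.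
  rewrite sum_card_sqroots_exp_odd ?Kq // (mulnCA _ (2 ^ g)%N) -expnSr => card_eq.
  (* The last summand is the exponent of q - 1 multiplying |X|, which is then cancelled. *)
  have nE : n = (n - m + g.+1 - 1 + (m - g.+1).+1)%N by lia.
  move: card_eq; rewrite {1}nE expnD mulnA => /eqP.
  rewrite eqn_pmul2r ?expn_gt0 ?(ltnW q1_gt1) // => /eqP.
  move/(congr1 (GRing.natmul (1 : rat))).
  rewrite natrM !natrX => <-.
  by rewrite subn1 /= mulrCA -exprMn mul1r mulVf // expr1n mulr1.
- case: gamma comp_gamma g_le_m card_eq => // g _ g_le_m + _ evenq.
  rewrite sum_card_sqroots_exp_even ?Kq // -expnSr => card_eq.
  have nE : n = (n - m + g.+1 - 1 + (m - g.+1).+1)%N by lia.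
  move: card_eq; rewrite {1}nE expnD => /eqP.
  by rewrite eqn_pmul2r ?expn_gt0 ?(ltnW q1_gt1) // => /eqP->; rewrite natrX.
- move=> g0; move: card_eq; rewrite g0 subn0 sum_nat_const muln1.
  rewrite -(cardsE (fun c : K => c != 0)) card_neq0 Kq -expnSr => card_eq.
  (* The truncated difference n - m - 1 needs m < n; it follows because (q - 1)^(m + 1) divides (q -
     1)^n and q - 1 > 1. *)
  have m_lt_n : (m < n)%N.
    by rewrite -(dvdn_Pexp2l _ _ q1_gt1) -card_eq dvdn_mull.
  have nE : n = (n - m - 1 + m.+1)%N by lia.
  move: card_eq; rewrite {1}nE expnD => /eqP.
  by rewrite eqn_pmul2r ?expn_gt0 ?(ltnW q1_gt1) // => /eqP->; rewrite natrX.
Qed.
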